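(* Let $p\in(\tfrac12,1)$. There exists a monotone isomorphism of the Bernoulli shifts $B(1-p,p)$ and $B(p,1-p)$. That is, there is a measurable map $\phi:\{0,1\}^{\mathbb Z}\to\{0,1\}^{\mathbb Z}$ such that: $\phi(x)_i\le x_i$ for all $x$ and all $i\in\mathbb Z$; $\phi\circ T=T\circ\phi$ holds on a set of full $(1-p,p)^{\mathbb Z}$-measure; the push-forward of $(1-p,p)^{\mathbb Z}$ under $\phi$ is $(p,1-p)^{\mathbb Z}$; and $\phi$ is invertible (on full-measure sets) with $\phi^{-1}$ a factor map from $B(p,1-p)$ to $B(1-p,p)$.
   Context: $\Omega=\{0,1\}^{\mathbb Z}$ and $T:\Omega\to\Omega$ is the left shift, $(Tx)_i=x_{i+1}$. For a probability vector $\mathbf p=(p_0,p_1)$ on $\{0,1\}$ ($p_0$ the probability of symbol $0$), $B(\mathbf p)=(\Omega,\mathbf p^{\mathbb Z},T)$ is the Bernoulli shift. Thus under $(1-p,p)^{\mathbb Z}$ each coordinate equals $1$ with probability $p$, and under $(p,1-p)^{\mathbb Z}$ each coordinate equals $1$ with probability $1-p$. A factor map from $B(\mathbf p)$ to $B(\mathbf q)$ is a measurable $\phi:\Omega\to\Omega$ pushing $\mathbf p^{\mathbb Z}$ to $\mathbf q^{\mathbb Z}$ with $\phi\circ T=T\circ\phi$ on a set of full $\mathbf p^{\mathbb Z}$-measure; an isomorphism is a factor map whose inverse is a factor map from $B(\mathbf q)$ to $B(\mathbf p)$; a factor map is monotone if $\phi(x)_i\le x_i$ for all $x\in\Omega$,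 $i\in\mathbb Z$. *)

(* Defs.v *)
From HB Require Import structures.
From mathcomp Require Import all_boot all_order all_algebra.
From mathcomp Require Import all_classical all_reals all_analysis.
Set Implicit Arguments. Unset Strict Implicit. Unset Printing Implicit Defensive.
Import Order.TTheory GRing.Theory Num.Theory.
Local Open Scope classical_set_scope.
Local Open Scope ring_scope.

Definition Omega0 := int -> bool.

Definition coord_cyl : set (set Omega0) :=
  [set A | exists (i : int) (b : bool), A = [set x | x i = b]].

Definition Omega := g_sigma_algebraType coord_cyl.
Definition Omega_disp := sigma_display coord_cyl.

Definition shift (x : Omega) : Omega := fun i => x (i + 1).

(* mu is the Bernoulli product measure (1-q, q)^Z, i.e. each coordinate
   equals 1 (true) with probability q, independently: every finite
   cylinder has the product probability. *)
Definition is_bernoulli (R : realType) (q : R)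
    (mu : probability Omega R) : Prop :=
  forall (F : seq int) (v : int -> bool), uniq F ->
    mu [set x : Omega | forall i, i \in F -> x i = v i]
    = (\prod_(i <- F) (if v i then q else 1 - q))%:E.

Definition factor_map (R : realType) (mu nu : probability Omega R)
    (phi : Omega -> Omega) : Prop :=
  [/\ measurable_fun setT phi,
      {ae mu, forall x, phi (shift x) = shift (phi x)} &
      forall A : set Omega, measurable A -> nu A = mu (phi @^-1` A)].

Definition isomorphism (R : realType) (mu nu : probability Omega R)
    (phi : Omega -> Omega) : Prop :=
  factor_map mu nu phi /\
  exists psi : Omega -> Omega,
    [/\ factor_map nu mu psi,
        {ae mu, forall x, psi (phi x) = x} &
        {ae nu, forall y, phi (psi y) = y}].

Definition monotone_map (phi : Omega -> Omega) : Prop :=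
  forall (x : Omega) (i : int), (phi x i <= x i)%N.

(* Main.v *)
(* Read 1 as an opening and 0 as a closing parenthesis.  Under density p > 1/2
   of ones, every 0 is almost surely matched with an earlier 1; [erase] turns
   each unmatched 1 into a 0.  The matched pairs are still matched to each other
   in the image, so the inverse turns each unmatched 0 into a 1; this is [erase]
   conjugated by reversing time and exchanging the two symbols.
   Read from right to left, x drives a queue with geometric stationary law whose
   output is [erase x], and Burke's theorem gives the law of the output. *)

Require Import Defs.
From HB Require Import structures.
From mathcomp Require Import all_boot all_order all_algebra.
From mathcomp Require Import all_classical all_reals all_analysis.
From mathcomp Require Import ring lra zify.
Import Order.TTheory GRing.Theory Num.Theory numFieldNormedType.Exports.
Local Open Scope ring_scope.
Local Open Scope classical_set_scope.

(* MathComp-Analysis also has a [shift]. *)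
Local Notation shift := Defs.shift.

(** * Cylinders over consecutive sites, which can grow by a letter at either end *)

Definition win (m : int) (w : seq bool) (x : Omega) : Prop :=
  forall j : nat, (j < size w)%N -> x (m + j%:Z) = nth false w j.

Lemma win_rcons (m : int) (w : seq bool) (c : bool) (x : Omega) :
  win m (rcons w c) x <-> win m w x /\ x (m + (size w)%:Z) = c.
Proof.
split=> [h|[h hc] j].
  split=> [j jw|]; last by rewrite h ?size_rcons// nth_rcons ltnn eqxx.
  by rewrite h ?size_rcons 1?ltnW// nth_rcons jw.
rewrite size_rcons ltnS leq_eqVlt nth_rcons => /orP[/eqP ->|jw].
  by rewrite ltnn eqxx.
by rewrite jw h.
Qed.

Lemma win_cons (m : int) (w : seq bool) (c : bool) (x : Omega) :
  win m (c :: w) x <-> x m = c /\ win (m + 1) w x.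
Proof.
split=> [h|[hc h] [|j] jw]; last 2 first.
- by rewrite addr0.
- by rewrite -add1n PoszD addrA h.
split=> [|j jw]; first by have := h 0%N isT; rewrite addr0.
by rewrite -addrA -PoszD add1n h.
Qed.

Lemma measurable_coord (i : int) (b : bool) :
  measurable [set x : Omega | x i = b].
Proof. by apply: sub_sigma_algebra; exists i, b. Qed.

Lemma measurable_win (m : int) (w : seq bool) : measurable (win m w : set Omega).
Proof.
elim/last_ind: w => [|w c IH].
  by rewrite (_ : win m [::] = setT)//; apply/seteqP; split.
rewrite (_ : win m (rcons w c) =
    win m w `&` [set x : Omega | x (m + (size w)%:Z) = c]); last first.
  by apply/seteqP; split=> x /= /win_rcons.
by apply: measurableI => //; exact: measurable_coord.
Qed.

Lemma measurable_fun_Omega (f : Omega -> Omega) :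
  (forall i, measurable [set x | f x i]) -> measurable_fun setT f.
Proof.
move=> mf; apply: (@measurability _ _ Omega Omega setT f coord_cyl) => //
  _ [_ [i [b ->]] <-].
rewrite setTI; case: b; first exact: mf.
rewrite (_ : _ @^-1` _ = ~` [set x | f x i]); first exact: measurableC.
by apply/seteqP; split=> x /=; case: (f x i).
Qed.

(** * Measures determined by consecutive cylinders *)

Section Measures.
Context {R : realType}.

Lemma measure_disjU (mu : probability Omega R) (A B C : set Omega) :
  measurable B -> measurable C ->
  (forall x, A x <-> B x \/ C x) -> (forall x, B x -> C x -> False) ->
  mu A = (mu B + mu C)%E.
Proof.
move=> mB mC ABC BC; rewrite -measureU//.
  by congr (mu _); apply/seteqP; split=> x /ABC.
by rewrite -subset0 => x [/BC].
Qed.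

Lemma measure_diff (mu : probability Omega R) (A B : set Omega) :
  measurable A -> measurable B -> B `<=` A ->
  mu (A `\` B) = (mu A - mu B)%E.
Proof.
move=> mA mB BA; rewrite measureD//; first by rewrite (setIidr BA).
by apply: le_lt_trans (ltry 1); exact: probability_le1.
Qed.

(** A pi-system argument: the sets depending only on the sites in [-n, n) for some n are finite
    disjoint unions of windows, are closed under intersection and generate the sigma-algebra. *)
Lemma win_determines (mu nu : probability Omega R) :
  (forall m w, mu (win m w) = nu (win m w)) ->
  forall A : set Omega, measurable A -> mu A = nu A.
Proof.
move=> eqw.
pose local (n : nat) (A : set Omega) := forall x y : Omega,
  (forall j : nat, (j < n.*2)%N -> x (- n%:Z + j%:Z) = y (- n%:Z + j%:Z)) ->
  A x -> A y.
have localS n m A : (n <= m)%N -> local n A -> local m A.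
  move=> nm lA x y xy; apply: lA => j jn.
  have /xy : (j + (m - n) < m.*2)%N by lia.
  by rewrite (_ : - m%:Z + (j + (m - n))%N%:Z = - n%:Z + j%:Z)//; lia.
have Gm n A : local n A -> measurable A /\ mu A = nu A.
  move=> lA.
  (* Induction on the number d of sites still free. At d = 0 the window fixes all that [A] depends
     on, so [A] contains it or misses it. *)
  have split_win d w : (d + size w = n.*2)%N ->
      measurable (A `&` win (- n%:Z) w) /\
      mu (A `&` win (- n%:Z) w) = nu (A `&` win (- n%:Z) w).
    elim: d w => [|d IH] w; rewrite ?add0n ?addSn => sw.
      have [[x [Ax wx]]|/forallNP nA] :=
        pselect (exists x, A x /\ win (- n%:Z) w x).
        rewrite (_ : A `&` _ = win (- n%:Z) w).
          by split; [exact: measurable_win|exact: eqw].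
        apply/seteqP; split=> [y []//|y wy]; split=> //.
        by apply: lA Ax => j; rewrite -sw => jw; rewrite wx// wy.
      rewrite (_ : A `&` _ = set0); first by rewrite !measure0.
      by rewrite -subset0 => y /nA.
    have [|mt et] := IH (rcons w true); first by rewrite size_rcons; lia.
    have [|mf ef] := IH (rcons w false); first by rewrite size_rcons; lia.
    have U x : (A `&` win (- n%:Z) w) x <->
        (A `&` win (- n%:Z) (rcons w true)) x \/
        (A `&` win (- n%:Z) (rcons w false)) x.
      split=> [[Ax wx]|[[Ax /win_rcons[wx _]]|[Ax /win_rcons[wx _]]]]//.
      by case E: (x (- n%:Z + (size w)%:Z)); [left|right]; split=> //;
        apply/win_rcons.
    have D x : (A `&` win (- n%:Z) (rcons w true)) x ->
        (A `&` win (- n%:Z) (rcons w false)) x -> False.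
      by move=> [_ /win_rcons[_ xt]] [_ /win_rcons[_]]; rewrite xt.
    split; last by rewrite !(measure_disjU _ _ _ _ mt mf U D) et ef.
    rewrite (_ : A `&` _ = (A `&` win (- n%:Z) (rcons w true)) `|`
        (A `&` win (- n%:Z) (rcons w false))); first exact: measurableU.
    by apply/seteqP; split=> x /U.
  have := split_win n.*2 [::]; rewrite addn0 => /(_ erefl).
  by rewrite (_ : A `&` _ = A)//; apply/seteqP; split=> x // [].
pose G := [set A | exists n, local n A].
apply: (@measure_unique _ _ _ G (fun=> setT)).
- apply/seteqP; split=> A.
    apply: smallest_sub; first exact: smallest_sigma_algebra.
    move=> _ [i [b ->]]; apply: sub_sigma_algebra.
    (* The successor is there because [-n, n) excludes its right end. *)
    exists (absz i).+1 => x y xy /=.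
    have /xy : (absz (i + (absz i).+1%:Z)%R < (absz i).+1.*2)%N by lia.
    by rewrite (_ : - _ + _ = i)//; [move=> -> | lia].
  apply: smallest_sub; first exact: sigma_algebra_measurable.
  by move=> B [n /Gm[]].
- move=> A B [n lA] [m lB]; exists (maxn n m) => x y xy [Ax Bx]; split.
    exact: (localS n _ _ (leq_maxl n m) lA x).
  exact: (localS m _ _ (leq_maxr n m) lB x).
- by move=> _; exists 0%N.
- by rewrite bigcup_const//; exists 0%N.
- by move=> A [n /Gm[]].
- by move=> _; apply: le_lt_trans (ltry 1); exact: probability_le1.
Qed.

Definition wt (q : R) (w : seq bool) : R :=
  \prod_(b <- w) (if b then q else 1 - q).

Lemma wt_rcons (q : R) (w : seq bool) (c : bool) :
  wt q (rcons w c) = wt q w * (if c then q else 1 - q).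
Proof. by rewrite /wt -cats1 big_cat big_seq1. Qed.

Lemma wt_cons (q : R) (w : seq bool) (c : bool) :
  wt q (c :: w) = (if c then q else 1 - q) * wt q w.
Proof. by rewrite /wt big_cons. Qed.

Lemma bernoulli_win (q : R) (mu : probability Omega R) (m : int)
    (w : seq bool) : is_bernoulli q mu -> mu (win m w) = (wt q w)%:E.
Proof.
move=> hmu.
pose F := [seq m + j%:Z | j <- iota 0 (size w)].
have uF : uniq F by rewrite map_inj_uniq ?iota_uniq// => i j /addrI [].
have vE (j : nat) : nth false w (absz (m + j%:Z - m)%R) = nth false w j.
  by congr nth; lia.
(* [absz (i - m)] recovers the position in [w] of a site i of the window. *)
have := hmu F (fun i => nth false w (absz (i - m)%R)) uF.
rewrite /F big_map; under eq_bigr do rewrite vE.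
rewrite /wt (big_nth false) /index_iota subn0 => <-; congr (mu _).
apply/seteqP; split=> [x wx i /mapP[j]|x wx j jw].
  by rewrite mem_iota => /wx + ->; rewrite vE.
by rewrite wx ?vE//; apply: map_f; rewrite mem_iota.
Qed.

End Measures.

(** * Queue lengths and the two maps *)

(* The number of 0s left unmatched within the window [n, n + M). *)
Fixpoint queue (M : nat) (n : int) (x : Omega) : nat :=
  if M is M'.+1 then
    if x n then (queue M' (n + 1) x).-1 else (queue M' (n + 1) x).+1
  else 0.

(* At least k of the 0s at or after n are unmatched within [n, oo); phrased
   without the limiting queue length, which may be infinite. *)
Definition pending (n : int) (k : nat) (x : Omega) : Prop :=
  exists M, (k <= queue M n x)%N.

Definition erase (x : Omega) : Omega :=
  fun n => x n && `[< pending (n + 1) 1 x >].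

(** The centre is -1/2 so that the cut between n - 1 and n goes to the cut between -n - 1 and -n:
    [pending (- n)] of the reflection looks left from the cut at which [pending n] looks right. *)
Definition reflect (y : Omega) : Omega := fun n => ~~ y (- 1 - n).

Definition restore (y : Omega) : Omega := reflect (erase (reflect y)).

Lemma queueS (M : nat) (n : int) (x : Omega) :
  queue M.+1 n x =
  if x n then (queue M (n + 1) x).-1 else (queue M (n + 1) x).+1.
Proof. by []. Qed.

(** Read from right to left, both queues undergo the same monotone steps, one from length 0 and the
    other from a length at least 0. *)
Lemma queue_leS (M : nat) (n : int) (x : Omega) :
  (queue M n x <= queue M.+1 n x)%N.
Proof.
elim: M n => [|M IH] n; first exact: leq0n.
have := IH (n + 1).
by rewrite (queueS M.+1) (queueS M n); case: (x n); lia.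
Qed.

Lemma pending0 (n : int) (x : Omega) : pending n 0 x.
Proof. by exists 0%N. Qed.

Lemma pendingW (n : int) (j k : nat) (x : Omega) :
  (j <= k)%N -> pending n k x -> pending n j x.
Proof. by move=> jk [M h]; exists M; exact: leq_trans h. Qed.

Lemma pending_true (n : int) (k : nat) (x : Omega) : x n ->
  pending n k.+1 x <-> pending (n + 1) k.+2 x.
Proof.
move=> xn; split=> [[[//|M]]|[M h]].
  by rewrite /= xn => h; exists M; lia.
by exists M.+1; rewrite /= xn; lia.
Qed.

Lemma pending_false (n : int) (k : nat) (x : Omega) : x n = false ->
  pending n k.+1 x <-> pending (n + 1) k x.
Proof.
move=> xn; split=> [[[//|M]]|[M h]].
  by rewrite /= xn => h; exists M; lia.
by exists M.+1; rewrite /= xn; lia.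
Qed.

Lemma measurable_queue (M : nat) (n : int) (k : nat) :
  measurable [set x : Omega | (k <= queue M n x)%N].
Proof.
elim: M n k => [|M IH] n [|k].
- by rewrite [X in measurable X](_ : _ = setT)//; apply/seteqP; split.
- by rewrite [X in measurable X](_ : _ = set0)//; apply/seteqP; split.
- by rewrite [X in measurable X](_ : _ = setT)//; apply/seteqP; split.
rewrite (_ : [set x : Omega | _] =
  ([set x : Omega | x n = true] `&` [set x | (k.+2 <= queue M (n + 1) x)%N]) `|`
  ([set x : Omega | x n = false] `&` [set x | (k <= queue M (n + 1) x)%N])).
  by apply: measurableU; apply: measurableI => //; exact: measurable_coord.
apply/seteqP; split=> x /=.
  by case: (x n) => h; [left|right]; split=> //; lia.
by case=> -[->]; lia.
Qed.

Lemma pending_bigcup (n : int) (k : nat) :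
  pending n k = \bigcup_M [set x : Omega | (k <= queue M n x)%N].
Proof. by apply/seteqP; split=> x [M]; [exists M|exists M]. Qed.

Lemma measurable_pending (n : int) (k : nat) :
  measurable (pending n k : set Omega).
Proof.
rewrite pending_bigcup; apply: bigcup_measurable => M _.
exact: measurable_queue.
Qed.

Lemma measurable_erase : measurable_fun setT erase.
Proof.
apply: measurable_fun_Omega => i.
rewrite (_ : [set _ | _] = [set x : Omega | x i = true] `&` pending (i + 1) 1).
  by apply: measurableI; [exact: measurable_coord|exact: measurable_pending].
apply/seteqP; split=> x; rewrite /= /erase; first by move=> /andP[? /asboolP].
by move=> [-> /asboolP].
Qed.

HB.instance Definition _ :=
  isMeasurableFun.Build _ _ _ _ erase measurable_erase.

Lemma measurable_reflect : measurable_fun setT reflect.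
Proof.
apply: measurable_fun_Omega => i.
rewrite (_ : [set _ | _] = [set x : Omega | x (- 1 - i) = false]).
  exact: measurable_coord.
by apply/seteqP; split=> x; rewrite /= /reflect; case: (x _).
Qed.

HB.instance Definition _ :=
  isMeasurableFun.Build _ _ _ _ reflect measurable_reflect.

Lemma measurable_restore : measurable_fun setT restore.
Proof.
apply: measurableT_comp; first exact: measurable_reflect.
by apply: measurableT_comp; [exact: measurable_erase|exact: measurable_reflect].
Qed.

Lemma erase_shift (x : Omega) : erase (shift x) = shift (erase x).
Proof.
have qs M n : queue M n (shift x) = queue M (n + 1) x.
  by elim: M n => //= M IH n; rewrite IH.
apply/funext => n; rewrite /erase /shift; congr andb.
by apply/asbool_equiv_eq; split=> -[M h]; exists M; move: h; rewrite qs.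
Qed.

Lemma shift_reflect_shift (y : Omega) : shift (reflect (shift y)) = reflect y.
Proof.
by apply/funext => i; rewrite /shift /reflect; congr (~~ y _); lia.
Qed.

Lemma restore_shift (y : Omega) : restore (shift y) = shift (restore y).
Proof.
rewrite /restore -(shift_reflect_shift y) erase_shift.
by rewrite shift_reflect_shift.
Qed.

Lemma restoreE (y : Omega) (n : int) :
  restore y n = y n || ~~ `[< pending (- n) 1 (reflect y) >].
Proof.
rewrite /restore {1}/reflect /erase negb_and {1}/reflect negbK.
by congr (y _ || ~~ `[< pending _ _ _ >]); lia.
Qed.

Lemma pending_reflect_erase (n : int) (k : nat) (x : Omega) :
  pending (- n) k (reflect (erase x)) -> pending n k x.
Proof.
case=> M; elim: M n k => [|M IH] n [|k]; do ?by move=> _; exact: pending0.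
  by [].
have -> : n = n - 1 + 1 by lia.
set n' := n - 1; rewrite /= {1}/reflect.
have -> : - 1 - - (n' + 1) = n' by lia.
have -> : - (n' + 1) + 1 = - n' by lia.
rewrite {1}/erase; case: ifPn.
  rewrite negb_and => xW q.
  have {q} /IH : (k.+2 <= queue M (- n') (reflect (erase x)))%N by lia.
  case E: (x n'); first by move=> /(pending_true _ _ _ E); apply: pendingW; lia.
  by move=> /(pending_false _ _ _ E); apply: pendingW.
rewrite negbK => /andP[xn /asboolP W].
rewrite ltnS => /IH; case: k => // k.
by move=> /(pending_true _ _ _ xn).
Qed.

Lemma eraseK_at (x : Omega) (n : int) :
  (pending n 1 x -> pending (- n) 1 (reflect (erase x))) ->
  restore (erase x) n = x n.
Proof.
move=> VW; rewrite restoreE {1}/erase.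
case E: (x n) => /=.
  case: (pselect (pending (n + 1) 1 x)) => W; first by rewrite asboolT.
  rewrite (asboolF W) /= asboolF// => /pending_reflect_erase.
  by move=> /(pending_true _ _ _ E) /(pendingW _ 1 2 _ isT).
by rewrite asboolT//; apply: VW; apply/(pending_false _ _ _ E); exact: pending0.
Qed.

Lemma reflectK : involutive reflect.
Proof.
by move=> y; apply/funext => i; rewrite /reflect negbK; congr (y _); lia.
Qed.

Lemma reflect_bernoulli {R : realType} (q : R) (nu : probability Omega R) :
  is_bernoulli q nu -> is_bernoulli (1 - q) (distribution nu reflect).
Proof.
move=> hnu F v uF; rewrite /distribution /pushforward.
have invo (i : int) : - 1 - (- 1 - i) = i by lia.
pose F' := [seq - 1 - i | i <- F].
have uF' : uniq F' by rewrite map_inj_uniq// => i j /=; lia.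
have := hnu F' (fun i => ~~ v (- 1 - i)) uF'.
rewrite /F' big_map; under eq_bigr do rewrite invo.
rewrite (_ : \prod_(i <- F) _ =
    \prod_(i <- F) (if v i then 1 - q else 1 - (1 - q))).
  move=> <-; congr (nu _); apply/seteqP; split=> x h i iF.
    by move: iF => /mapP[j jF ->]; rewrite invo -h// /reflect negbK.
  move: h => /= h.
  by rewrite /reflect h; [rewrite invo negbK|apply/mapP; exists i].
by apply: eq_bigr => i _; case: (v i) => //=; ring.
Qed.

Section Law.
Context {R : realType} (p : R).
Hypotheses (hp1 : 2^-1 < p) (hp2 : p < 1).

Let rho : R := (1 - p) / p.

Let p_gt0 : 0 < p. Proof. by apply: lt_trans hp1; rewrite invr_gt0. Qed.

Let prho : p * rho = 1 - p.
Proof. by rewrite /rho mulrC divfK// gt_eqF. Qed.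

Let rho_gt0 : 0 < rho. Proof. by rewrite divr_gt0// subr_gt0. Qed.

Let rho_lt1 : rho < 1.
Proof. by rewrite /rho ltr_pdivrMr//; move: hp1; lra. Qed.

(* The probability that a walk with up-probability p reaches -k in M steps. *)
Fixpoint hit (M k : nat) : R :=
  match M, k with
  | _, 0 => 1
  | 0, _ => 0
  | M'.+1, k'.+1 => p * hit M' k'.+2 + (1 - p) * hit M' k'
  end.

Lemma hit0 (M : nat) : hit M 0 = 1. Proof. by case: M. Qed.

Lemma hit_cvg (k : nat) : hit M k @[M --> \oo] --> rho ^+ k.
Proof.
(* p t + (1 - p) / t < 1 exactly for t in (rho, 1): any s there
   makes theta ^ M * s ^ k dominate the error, which solves the recursion
   of [hit]. *)
pose s := (1 + rho) / 2.
have s_gt0 : 0 < s by rewrite /s; move: rho_gt0; lra.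
have s_lt1 : s < 1 by rewrite /s; move: rho_lt1; lra.
have rho_s : rho < s by rewrite /s; move: rho_lt1; lra.
pose theta := (p * s ^+ 2 + (1 - p)) / s.
have thetas : theta * s = p * s ^+ 2 + (1 - p).
  by rewrite /theta divfK// gt_eqF.
have theta_gt0 : 0 < theta.
  apply: divr_gt0 => //; apply: addr_gt0; last by rewrite subr_gt0.
  by rewrite mulr_gt0// exprn_gt0.
have theta_lt1 : theta < 1.
  rewrite /theta ltr_pdivrMr// mul1r -subr_gt0.
  have -> : s - (p * s ^+ 2 + (1 - p)) = (1 - s) * p * (s - rho).
    by rewrite -mulrA mulrBr prho; ring.
  by rewrite !mulr_gt0// subr_gt0.
have bnd M j : 0 <= rho ^+ j - hit M j <= theta ^+ M * s ^+ j.
  elim: M j => [|M IH] [|j].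
  - by rewrite !expr0 /= subrr mul1r lexx ler01.
  - rewrite [hit _ _]/= subr0 expr0 mul1r (exprn_ge0 _ (ltW rho_gt0))/=.
    by rewrite lerXn2r ?nnegrE ?ltW.
  - by rewrite !expr0 /= subrr lexx mulr1 exprn_ge0// ltW.
  - have -> : rho ^+ j.+1 - hit M.+1 j.+1 =
        p * (rho ^+ j.+2 - hit M j.+2) + (1 - p) * (rho ^+ j - hit M j).
      have rr : rho = p * rho ^+ 2 + (1 - p).
        rewrite -[LHS]mul1r -(subrK p 1) mulrDl prho expr2 mulrA prho; lra.
      rewrite /= !exprS; move: rr; rewrite expr2 => rr.
      rewrite [X in X * _ - _]rr; lra.
    have -> : theta ^+ M.+1 * s ^+ j.+1 =
        p * (theta ^+ M * s ^+ j.+2) + (1 - p) * (theta ^+ M * s ^+ j).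
      rewrite !exprS.
      have -> : theta * theta ^+ M * (s * s ^+ j) =
        (theta * s) * (theta ^+ M * s ^+ j) by ring.
      rewrite thetas; ring.
    have [/andP[a1 a2] /andP[b1 b2]] := (IH j.+2, IH j).
    have q_ge0 : 0 <= 1 - p by rewrite subr_ge0 ltW.
    have p_ge0 := ltW p_gt0.
    by rewrite addr_ge0 ?mulr_ge0//= lerD// ler_wpM2l.
apply: (@squeeze_cvgr _ _ _ R
  (fun M => rho ^+ k - geometric (s ^+ k) theta M) (fun=> rho ^+ k));
  last exact: cvg_cst.
  near=> M; have /andP[b1 b2] := bnd M k.
  by move: b1 b2; rewrite /= (mulrC (s ^+ k)); lra.
rewrite -[X in _ --> X]subr0; apply: cvgB; first exact: cvg_cst.
by apply: cvg_geometric; rewrite gtr0_norm.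
Unshelve. all: by end_near. Qed.

Lemma win_queue (mu : probability Omega R) (m : int) (v : seq bool)
    (M k : nat) : is_bernoulli p mu ->
  mu (win m v `&` [set x | (k <= queue M (m + (size v)%:Z) x)%N]) =
  (wt p v * hit M k)%:E.
Proof.
move=> hmu; elim: M v k => [|M IH] v [|k].
- rewrite hit0 mulr1 -(bernoulli_win p mu m)//; congr (mu _).
  by apply/seteqP; split=> x // [].
- rewrite /= mulr0 [X in mu X](_ : _ = set0) ?measure0//.
  by rewrite -subset0 => x [].
- rewrite hit0 mulr1 -(bernoulli_win p mu m)//; congr (mu _).
  by apply/seteqP; split=> x // [].
have mE c j : measurable (win m (rcons v c) `&`
    [set x | (j <= queue M (m + (size (rcons v c))%:Z) x)%N]).
  by apply: measurableI; [exact: measurable_win|exact: measurable_queue].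
rewrite (measure_disjU mu _ _ _ (mE true k.+2) (mE false k)).
- rewrite (IH (rcons v true) k.+2) (IH (rcons v false) k) !wt_rcons -EFinD /=.
  by congr EFin; ring.
- have e c : m + (size (rcons v c))%:Z = m + (size v)%:Z + 1.
    by rewrite size_rcons; lia.
  move=> x; rewrite /= !e; split=> [[wx]|].
    case E: (x (m + (size v)%:Z)) => q; [left|right]; split;
      do ?by apply/win_rcons.
      by lia.
    by lia.
  by case=> -[/win_rcons[wx ->]] q; split=> //; lia.
- by move=> x [/win_rcons[_ xt] _] [/win_rcons[_]]; rewrite xt.
Qed.

Lemma win_pending (mu : probability Omega R) (m : int) (v : seq bool)
    (k : nat) : is_bernoulli p mu ->
  mu (win m v `&` pending (m + (size v)%:Z) k) = (wt p v * rho ^+ k)%:E.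
Proof.
move=> hmu; rewrite pending_bigcup setI_bigcupr.
set F := fun M => _ `&` _.
have mF M : measurable (F M).
  by apply: measurableI; [exact: measurable_win|exact: measurable_queue].
have ndF : nondecreasing_seq F.
  apply/nondecreasing_seqP => M; apply/subsetPset => x [wx q]; split=> //.
  exact: leq_trans q (queue_leS _ _ _).
have cvF : mu (F M) @[M --> \oo] --> mu (\bigcup_M F M).
  by apply: nondecreasing_cvg_mu => //; exact: bigcup_measurable.
rewrite -(cvg_lim (@ereal_hausdorff R) cvF).
under eq_fun do rewrite win_queue//.
apply: cvg_lim; first exact: ereal_hausdorff.
apply: cvg_EFin; first exact: nearW.
by apply: cvgM; [exact: cvg_cst|exact: hit_cvg].
Qed.

(* Burke's theorem for this queue: the output is independent of the queue
   length in front of it. *)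
Lemma win_pending_erase (mu : probability Omega R) (m : int)
    (v w : seq bool) (k : nat) : is_bernoulli p mu ->
  mu (win m v `&` (pending (m + (size v)%:Z) k `&`
      erase @^-1` (win (m + (size v)%:Z) w))) =
  (wt p v * rho ^+ k * wt (1 - p) w)%:E.
Proof.
move=> hmu.
pose E v w k := win m v `&` (pending (m + (size v)%:Z) k `&`
      erase @^-1` (win (m + (size v)%:Z) w)).
have mE v' w' k' : measurable (E v' w' k').
  apply: measurableI; first exact: measurable_win.
  apply: measurableI; first exact: measurable_pending.
  rewrite -[X in measurable X]setTI; apply: measurable_erase => //.
  exact: measurable_win.
have e u c : m + (size (rcons u c))%:Z = m + (size u)%:Z + 1.
  by rewrite size_rcons; lia.
rewrite -/(E v w k); elim: w v k => [|c w IH] v k.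
  rewrite /wt big_nil mulr1 -(win_pending mu m)//; congr (mu _).
  by apply/seteqP; split=> x [wx]; [case|move=> px; split=> //; split].
have Ecase x : E v (c :: w) k x <-> [/\ win m v x,
    pending (m + (size v)%:Z) k x, erase x (m + (size v)%:Z) = c &
    win (m + (size v)%:Z + 1) w (erase x)].
  by split=> [[? [? /win_cons[]]]//|[? ? ? ?]]; do 2!split=> //; apply/win_cons.
case: c => [|] in Ecase *.
  rewrite [X in mu X](_ : _ = E (rcons v true) w k.+1).
    rewrite IH wt_rcons wt_cons exprS.
    congr EFin; rewrite -prho; ring.
  apply/seteqP; split=> x; rewrite Ecase /E /= e.
    move=> [wx px /andP[xn /asboolP W] ow]; split; first exact/win_rcons.
    by split=> //; case: k px {Ecase} => // k /(pending_true _ _ _ xn).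
  move=> [/win_rcons[wx xn] [px ow]]; split=> //; last first.
    by rewrite /erase xn; apply/asboolP; exact: pendingW px.
  case: k px {Ecase} => [|k] px; first exact: pending0.
  exact/(pending_true _ _ _ xn).
case: k => [|k] in Ecase *.
  rewrite (measure_disjU mu _ _ (E (rcons v true) w 0 `\` E (rcons v true) w 1)
    (mE (rcons v false) w 0)).
  - rewrite (measure_diff mu)//; last first.
      by move=> x [? [? ?]]; do 2!split=> //; exact: pending0.
    rewrite !IH !wt_rcons wt_cons expr0 expr1 -EFinB -EFinD.
    congr EFin; move: prho => pr.
    have -> : wt p v * p * rho * wt (1 - p) w = wt p v * wt (1 - p) w * (1 - p).
      by rewrite -pr; ring.
    ring.
  - exact: measurableD.
  - move=> x; rewrite Ecase /E /= !e; split.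
      move=> [wx px ex ow]; case xn: (x (m + (size v)%:Z)); [right|left].
        split; first by split; [exact/win_rcons|split=> //; exact: pending0].
        by move: ex; rewrite /erase xn /= => /asboolP nW [_ []].
      by split; [exact/win_rcons|split=> //; exact: pending0].
    case=> [[/win_rcons[wx xn] [_ ow]]|[[wrx [_ ow]] nW]].
      by split=> //; [exact: pending0|rewrite /erase xn].
    have /win_rcons[wx xn] := wrx.
    split=> //; first exact: pending0.
    by rewrite /erase xn /= asboolF// => W; apply: nW.
  - by move=> x [/win_rcons[_ xf] _] [[/win_rcons[_]]]; rewrite xf.
rewrite [X in mu X](_ : _ = E (rcons v false) w k).
  rewrite IH wt_rcons wt_cons exprS.
  congr EFin; rewrite -{1}prho; ring.
apply/seteqP; split=> x; rewrite Ecase /E /= e.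
  move=> [wx px ex ow].
  have xn : x (m + (size v)%:Z) = false.
    apply/negP => xn; move: ex; rewrite /erase xn => /asboolP; apply.
    by move/(pending_true _ _ _ xn): px; exact: pendingW.
  split; first exact/win_rcons.
  by split=> //; exact/(pending_false _ _ _ xn).
move=> [/win_rcons[wx xn] [px ow]]; split=> //; last by rewrite /erase xn.
exact/(pending_false _ _ _ xn).
Qed.

Lemma erase_law (mu nu : probability Omega R) :
  is_bernoulli p mu -> is_bernoulli (1 - p) nu ->
  forall A : set Omega, measurable A -> nu A = mu (erase @^-1` A).
Proof.
move=> hmu hnu A mA.
apply: (win_determines nu (distribution mu erase)) => // m w.
rewrite (bernoulli_win (1 - p))// /distribution /pushforward.
have := win_pending_erase mu m [::] w 0 hmu.
rewrite /wt big_nil expr0 !mul1r => <-; congr (mu _).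
rewrite addr0; apply/seteqP; split=> x; first by move=> [_ []].
by split=> //; split=> //; exact: pending0.
Qed.

Lemma pending_law (mu : probability Omega R) (n : int) :
  is_bernoulli p mu -> mu (pending n 1) = rho%:E.
Proof.
move=> hmu; have := win_pending mu n [::] 1 hmu.
rewrite /wt big_nil expr1 mul1r addr0 => <-; congr (mu _).
by apply/seteqP; split=> x // [].
Qed.

(* The queue of the output never exceeds that of the input, and by symmetry
   both are nonempty with probability rho, so they are nonempty together. *)
Lemma restore_erase_ae (mu nu : probability Omega R) :
  is_bernoulli p mu -> is_bernoulli (1 - p) nu ->
  {ae mu, forall x, restore (erase x) = x}.
Proof.
move=> hmu hnu.
have H n : {ae mu, forall x,
    pending n 1 x -> pending (- n) 1 (reflect (erase x))}.
  pose B : set Omega := reflect @^-1` (pending (- n) 1).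
  have mB : measurable B.
    rewrite -[B]setTI; apply: measurable_reflect => //.
    exact: measurable_pending.
  have nuB : nu B = rho%:E.
    have := reflect_bernoulli (1 - p) nu hnu; rewrite subKr.
    exact: pending_law.
  have mA := measurable_pending n 1.
  have meB : measurable (erase @^-1` B).
    by rewrite -[X in measurable X]setTI; exact: measurable_erase.
  exists (pending n 1 `\` erase @^-1` B); split; first exact: measurableD.
  - rewrite (measure_diff mu)//; last by move=> x; exact: pending_reflect_erase.
    rewrite -(erase_law mu nu)// pending_law//.
    by rewrite nuB subee.
  - by move=> x /= /not_implyP.
have Hpos : {ae mu, forall x, forall j : nat,
    pending j%:Z 1 x -> pending (- j%:Z) 1 (reflect (erase x))}.
  by apply: ae_foralln => j; exact: H.
have Hneg : {ae mu, forall x, forall j : nat,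
    pending (Negz j) 1 x -> pending (- Negz j) 1 (reflect (erase x))}.
  by apply: ae_foralln => j; exact: H.
apply: filterS2 Hpos Hneg => x hpos hneg; apply/funext => n.
by apply: eraseK_at; case: n => n; [exact: hpos|exact: hneg].
Qed.

End Law.

Theorem theorem1 (R : realType) (p : R) (hp1 : 2^-1 < p) (hp2 : p < 1)
    (mu nu : probability Omega R)
    (hmu : is_bernoulli p mu) (hnu : is_bernoulli (1 - p) nu) :
  exists phi : Omega -> Omega, monotone_map phi /\ isomorphism mu nu phi.
Proof.
pose mu' := distribution mu reflect; pose nu' := distribution nu reflect.
have hmu' : is_bernoulli (1 - p) mu' by exact: reflect_bernoulli.
have hnu' : is_bernoulli p nu'.
  by have := reflect_bernoulli (1 - p) nu hnu; rewrite subKr.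
exists erase; split.
  by move=> x i; rewrite /erase; case: (x i) => //=; exact: leq_b1.
split.
  split; first exact: measurable_erase.
    by apply: aeW; exact: erase_shift.
  exact: (erase_law p hp1 hp2 mu nu hmu hnu).
exists restore; split.
- split; first exact: measurable_restore.
    by apply: aeW; exact: restore_shift.
  move=> A mA.
  have mrA : measurable (reflect @^-1` A).
    by rewrite -[X in measurable X]setTI; exact: measurable_reflect.
  transitivity (mu' (reflect @^-1` A)); last first.
    exact: (erase_law p hp1 hp2 nu' mu' hnu' hmu' _ mrA).
  change (mu A = mu (reflect @^-1` (reflect @^-1` A))).
  by congr (mu _); apply/seteqP; split=> x /=; rewrite reflectK.
- exact: (restore_erase_ae p hp1 hp2 mu nu hmu hnu).
- have [N [mN N0 subN]] := restore_erase_ae p hp1 hp2 nu' mu' hnu' hmu'.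
  exists (reflect @^-1` N); split=> //.
    by rewrite -[X in measurable X]setTI; exact: measurable_reflect.
  move=> y ny; apply: subN => /= ry; apply: ny.
  by apply: (can_inj reflectK); rewrite -[RHS]ry.
Qed.
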